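(* Let $(E,\pi)$ be a Jordan Banach triple system. Suppose that the extension $\pi^0$ is symmetric in the outer variables. Then the following statements hold: (i) The mapping $Q^{\pi^0}(m)Q^{\pi^0}(n):E^{**}\to E^{**}$ is weak$^*$-continuous for every $m,n\in E^{**}$. (ii) If $e$ is a tripotent in $E$, then $Q^{\pi^0}(m,n):E^{**}\to E^{**}$ is weak$^*$-continuous for every $m,n\in (E^{**})_2(e)$. (iii) If for each $m\in E^{**}$ there exists a tripotent $e\in E$ such that $m\in (E^{**})_2(e)$, then $\pi^0$ is separately weak$^*$-continuous, and hence $(E,\pi)$ is Aron--Berner regular. (iv) If $u$ is a unitary tripotent in $E$, then $u$ is a unitary tripotent in $(E^{**},\pi^0)$, $\pi^0$ is separately weak$^*$-continuous, and $(E,\pi)$ is Aron--Berner regular.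
   Context: Jordan Banach triple systems are taken complex: a complex Banach space $E$ with a jointly continuous map $\pi=\{\cdot,\cdot,\cdot\}:E\times E\times E\to E$ which is bilinear and symmetric in the outer variables, conjugate linear in the middle one, and satisfies the Jordan identity $\{a,b,\{c,d,e\}\}=\{\{a,b,c\},d,e\}-\{c,\{b,a,d\},e\}+\{c,d,\{a,b,e\}\}$ for all $a,b,c,d,e\in E$. $E$ is identified with its canonical image in $E^{**}$. The six Aron--Berner extensions $\pi^0,\dots,\pi^5:E^{**}\times E^{**}\times E^{**}\to E^{**}$ of $\pi$ (bilinear in the outer variables, conjugate linear in the middle one) are given by iterated $w^*$-limits: for $m,n,p\in E^{**}$ and bounded nets $(m_{\alpha_1}),(n_{\alpha_2}),(p_{\alpha_3})$ in $E$ converging in the $w^*$-topology to $m,n,p$ respectively, $\pi^i(m,n,p)=w^*\text{-}\lim_{\alpha_{\sigma_i(1)}}\lim_{\alpha_{\sigma_i(2)}}\lim_{\alpha_{\sigma_i(3)}}\pi(m_{\alpha_1},n_{\alpha_2},p_{\alpha_3})$ (all limits in the $w^*$-topology, the rightmost limit taken first; the result does not depend on the nets), where $(\sigma_i(1),\sigma_i(2),\sigma_i(3))$ is $(1,2,3)$ for $i=0$, $(1,3,2)$ for $i=1$, $(3,2,1)$ for $i=2$, $(2,1,3)$ for $i=3$, $(3,1,2)$ for $i=4$, $(2,3,1)$ for $i=5$. $(E,\pi)$ is called Aron--Berner regular if $\pi^0=\pi^1=\dots=\pi^5$. ''$\pi^0$ symmetric in the outer variables'' means $\pi^0(m,n,p)=\pi^0(p,n,m)$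 for all $m,n,p\in E^{**}$ (in that case $(E^{**},\pi^0)$ is itself a Jordan Banach triple system). ''Separately weak$^*$-continuous'' means $w^*$-to-$w^*$ continuous in each variable when the other two are fixed. For a Jordan Banach triple system $(F,\rho)$ and $a,b\in F$: $Q^{\rho}(a,b)$ is the conjugate linear map $x\mapsto \rho(a,x,b)$ on $F$, and $Q^{\rho}(a)=Q^{\rho}(a,a)$; products of such maps are compositions. An element $e\in F$ is a tripotent if $\rho(e,e,e)=e$; its Peirce 2-space is $F_2(e)=\{x\in F:\rho(e,e,x)=x\}$; the tripotent $e$ is unitary if $F_2(e)=F$. The space $(E^{**})_2(e)$ is taken with respect to the triple product $\pi^0$. *)

(* Defs.v *)
From HB Require Import structures.
From mathcomp Require Import all_boot all_order all_algebra complex.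
From mathcomp Require Import all_classical all_reals all_analysis.

Set Implicit Arguments.
Unset Strict Implicit.
Unset Printing Implicit Defensive.

Import Order.TTheory GRing.Theory Num.Theory.
Import numFieldNormedType.Exports.

Local Open Scope classical_set_scope.
Local Open Scope ring_scope.

Section DualSpace.
Variables (R : realType) (V : normedModType R[i]).

Definition continuous_functional : {pred V -> R[i]^o} :=
  mem [set f : V -> R[i]^o | linear f /\ continuous f].

Record dual := Dual {
  dual_val :> V -> R[i]^o;
  dual_valP : dual_val \in continuous_functional }.

HB.instance Definition _ := [isSub for dual_val].
HB.instance Definition _ := [Choice of dual by <:].

Lemma continuous_functional_submod_closed :
  submod_closed continuous_functional.
Proof.
split.
  by rewrite inE; split=> [a u v|]; [rewrite scaler0 addr0|exact: cst_continuous].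
move=> a f g /set_mem[lf cf] /set_mem[lg cg]; rewrite inE; split => [b u v|x].
  rewrite /= !fctE lf lg !scalerDr !scalerA addrACA.
  by rewrite (mulrC a b).
by apply: cvgD; [apply: cvgZr; exact: cf|exact: cg].
Qed.

HB.instance Definition _ := GRing.isSubmodClosed.Build _ _
  continuous_functional continuous_functional_submod_closed.
HB.instance Definition _ := [SubChoice_isSubLmodule of dual by <:].

Lemma dual_linear (f : dual) : linear f.
Proof. by case: f => f /= /set_mem[]. Qed.

Lemma dual_continuous (f : dual) : continuous f.
Proof. by case: f => f /= /set_mem[]. Qed.

HB.instance Definition _ (f : dual) :=
  GRing.isLinear.Build R[i] V R[i]^o _ f (@dual_linear f).

Lemma dual_ext (f g : dual) : f =1 g -> f = g.
Proof. by move=> fg; apply/val_inj/funext. Qed.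

Definition opnorm (f : dual) : R :=
  sup [set complex.Re `|f x| | x in [set x : V | `|x| <= 1]].

Lemma ReK_ge0 (c : R[i]) : 0 <= c -> (complex.Re c)%:C%C = c.
Proof. by move=> c0; apply: RRe_real; exact: ger0_real. Qed.

Lemma dual_bounded (f : dual) :
  exists2 M : R, 0 <= M & forall x, `|f x| <= M%:C%C * `|x|.
Proof.
have /linear_bounded_continuous/linear_boundedP := @dual_continuous f.
move=> /pinfty_ex_gt0[M M0 Mf]; have MR : (complex.Re M)%:C%C = M.
  by apply: RRe_real; exact: gtr0_real.
exists (complex.Re M); first by rewrite -ler0c MR ltW.
by move=> x; rewrite MR; exact: Mf.
Qed.

Lemma opnorm_has_sup (f : dual) :
  has_sup [set complex.Re `|f x| | x in [set x : V | `|x| <= 1]].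
Proof.
split; first by exists (complex.Re `|f 0|), 0 => //; rewrite mksetE normr0.
have [M M0 Mf] := dual_bounded f; exists M => _ [x x1 <-].
rewrite -lecR ReK_ge0//; apply: (le_trans (Mf x)).
by rewrite ler_piMr// ler0c.
Qed.

Lemma opnorm_ge0 (f : dual) : 0 <= opnorm f.
Proof.
apply: (@le_trans _ _ (complex.Re `|f 0|)).
  by rewrite -ler0c ReK_ge0.
by apply: (ub_le_sup (opnorm_has_sup f).2); exists 0 => //; rewrite mksetE normr0.
Qed.

Lemma le_opnorm (f : dual) (x : V) : `|f x| <= (opnorm f)%:C%C * `|x|.
Proof.
have [->|x0] := eqVneq x 0; first by rewrite linear0 !normr0 mulr0.
have nx0 : `|x| != 0 by rewrite normr_eq0.
rewrite -ler_pdivrMr ?normr_gt0//.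
have -> : `|f x| / `|x| = `|f (`|x|^-1 *: x)|.
  by rewrite linearZ/= normrZ normfV normr_id mulrC.
rewrite -(ReK_ge0 (normr_ge0 _)) lecR; apply: (ub_le_sup (opnorm_has_sup f).2).
by exists (`|x|^-1 *: x) => //; rewrite mksetE normrZ normfV normr_id mulVf.
Qed.

Lemma opnorm_le (f : dual) (M : R) :
  0 <= M -> (forall x, `|f x| <= M%:C%C * `|x|) -> opnorm f <= M.
Proof.
move=> M0 Mf; apply: ge_sup; first exact: (opnorm_has_sup f).1.
move=> _ [x x1 <-].
rewrite -lecR ReK_ge0//; apply: (le_trans (Mf x)).
by rewrite ler_piMr// ler0c.
Qed.

Definition dual_norm (f : dual) : R[i] := (opnorm f)%:C%C.

Lemma ler_dual_normD f g : dual_norm (f + g) <= dual_norm f + dual_norm g.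
Proof.
rewrite /dual_norm -rmorphD lecR; apply: opnorm_le.
  by rewrite addr_ge0// opnorm_ge0.
move=> x; rewrite rmorphD mulrDl (le_trans (ler_normD _ _))//.
by rewrite lerD// le_opnorm.
Qed.

Let opnormZ_le (l : R[i]) f :
  opnorm (l *: f) <= complex.Re `|l| * opnorm f.
Proof.
have lK := ReK_ge0 (normr_ge0 l).
apply: opnorm_le.
  by apply: mulr_ge0; [rewrite -ler0c lK|exact: opnorm_ge0].
move=> x; have lfx : `|(l *: f) x| = `|l| * `|f x| by rewrite -normrZ.
rewrite lfx.
have -> : (complex.Re `|l| * opnorm f)%:C%C = `|l| * (opnorm f)%:C%C.
  by rewrite -[in RHS]lK -rmorphM.
by rewrite -mulrA; apply: ler_wpM2l => //; exact: le_opnorm.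
Qed.

Lemma dual_normZ (l : R[i]) f : dual_norm (l *: f) = `|l| * dual_norm f.
Proof.
have le k g : dual_norm (k *: g) <= `|k| * dual_norm g.
  by rewrite -(ReK_ge0 (normr_ge0 k)) -rmorphM lecR opnormZ_le.
apply/eqP; rewrite eq_le le/=.
have [->|l0] := eqVneq l 0.
  by rewrite normr0 mul0r /dual_norm ler0c opnorm_ge0.
rewrite -ler_pdivlMl ?normr_gt0// -normfV.
by rewrite (le_trans _ (le _ _))// scalerA mulVf// scale1r.
Qed.

Lemma dual_norm0_eq0 f : dual_norm f = 0 -> f = 0.
Proof.
move=> f0; apply: dual_ext => x; apply/eqP; rewrite -normr_le0.
by rewrite (le_trans (le_opnorm f x))// -/(dual_norm f) f0 mul0r.
Qed.

HB.instance Definition _ :=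
  Lmodule_isNormed.Build R[i] dual ler_dual_normD dual_normZ dual_norm0_eq0.

End DualSpace.


Lemma le_dual_norm (R : realType) (V : normedModType R[i]) (f : dual V) (x : V) :
  `|f x| <= `|f| * `|x|.
Proof. exact: le_opnorm. Qed.

Section WeakStar.
Variables (R : realType) (V : normedModType R[i]).

(* Alias of dual V: the norm topology lives on dual V, the weak* topology on
   weakstar V. *)
Definition weakstar : Type :=
  initial_topology (fun f : dual V => (f : {ptws V -> R[i]^o})).

HB.instance Definition _ := Topological.on weakstar.

Lemma weakstar_cvgP (F : set_system weakstar) (f : weakstar) : Filter F ->
  F --> f <->
  forall x : V, (g : dual V) x @[g --> F] --> (f : dual V) x.
Proof.
move=> FF; pose ev (g : weakstar) : {ptws V -> R[i]^o} := g : dual V.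
have evF : F --> f <-> ev @ F --> ev f.
  split=> [Ff|evFf A].
    exact: cvg_trans (cvg_app ev Ff) (@initial_continuous _ _ ev f).
  rewrite nbhsE => -[_ [[B Bo <-] Bf] BA].
  by apply: filterS BA _; apply: evFf; exact: open_nbhs_nbhs.
by rewrite evF; exact: pointwise_cvgP.
Qed.

Definition weakstar_continuous (T : dual V -> dual V) : Prop :=
  continuous (T : weakstar -> weakstar).

End WeakStar.

Notation bidual E := (dual (dual E)).

Section CanonicalEmbedding.
Variables (R : realType) (E : normedModType R[i]) (x : E).

Let eval (f : dual E) : R[i]^o := f x.

Let eval_linear : linear eval.
Proof. by []. Qed.

HB.instance Definition _ :=
  GRing.isLinear.Build R[i] (dual E) R[i]^o _ eval eval_linear.

Lemma eval_continuous_functional : eval \in @continuous_functional R (dual E).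
Proof.
rewrite inE; split; first exact: eval_linear.
apply/linear_bounded_continuous/bounded_funP => r; exists (r * `|x|) => f fr.
by rewrite (le_trans (le_dual_norm f x))// ler_wpM2r.
Qed.

Definition canonical_embedding : bidual E := Dual eval_continuous_functional.

End CanonicalEmbedding.

Section TripleProduct.
Variables (R : realType) (E : normedModType R[i]).

Record jordan_triple_product (t : E -> E -> E -> E) : Prop := {
  triple_linearl : forall b c, linear (fun a => t a b c);
  triple_linearr : forall a b, linear (t a b);
  triple_conj_linear : forall a c (k : R[i]) b b',
    t a (k *: b + b') c = k^* *: t a b c + t a b' c;
  triple_sym : forall a b c, t a b c = t c b a;
  triple_continuous : continuous (fun x : E * E * E => t x.1.1 x.1.2 x.2);
  triple_jordan : forall a b c d e,
    t a b (t c d e) = t (t a b c) d e - t c (t b a d) e + t c d (t a b e) }.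

End TripleProduct.

Section Tripotents.
Variables (F : Type) (t : F -> F -> F -> F).

Definition tripotent (e : F) : Prop := t e e e = e.

Definition peirce2 (e : F) : set F := [set x | t e e x = x].

Definition unitary_tripotent (e : F) : Prop :=
  tripotent e /\ peirce2 e = setT.

Definition quad (a b : F) : F -> F := fun x => t a x b.

End Tripotents.

Definition iterated_cvg (X : Type) (T : topologicalType) (g : X -> X -> X -> T)
    (F G H : set_system X) (l : T) : Prop :=
  exists (h2 : X -> X -> T) (h1 : X -> T),
    [/\ forall x y, g x y z @[z --> H] --> h2 x y,
        forall x, h2 x y @[y --> G] --> h1 x
      & h1 x @[x --> F] --> l].

Section AronBerner.
Variables (R : realType) (E : normedModType R[i]).

(* A net in E is represented by its filter of tails, a proper filter on E. *)
Definition bounded_wstar_net (F : set_system E) (m : bidual E) : Prop :=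
  [/\ ProperFilter F, bounded_near id F
    & (canonical_embedding x : weakstar (dual E)) @[x --> F] -->
      (m : weakstar (dual E))].

Variable t : E -> E -> E -> E.

Let jt (x y z : E) : weakstar (dual E) := canonical_embedding (t x y z).

Definition aron_berner_limit (i : 'I_6) (Fm Fn Fp : set_system E) :
    weakstar (dual E) -> Prop :=
  match val i with
  | 0%N => iterated_cvg (fun x y z => jt x y z) Fm Fn Fp
  | 1%N => iterated_cvg (fun x z y => jt x y z) Fm Fp Fn
  | 2%N => iterated_cvg (fun z y x => jt x y z) Fp Fn Fm
  | 3%N => iterated_cvg (fun y x z => jt x y z) Fn Fm Fp
  | 4%N => iterated_cvg (fun z x y => jt x y z) Fp Fm Fn
  | _ => iterated_cvg (fun y z x => jt x y z) Fn Fp Fm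
  end.

(* The common value of the iterated limit over all bounded nets. For a
   continuous triple product it exists, and it is unique because every element
   of the bidual is the weak* limit of a bounded net of E (Goldstine), so the
   default value 0 is never used. *)
Definition aron_berner (i : 'I_6) (m n p : bidual E) : bidual E :=
  xget 0 [set l : bidual E | forall Fm Fn Fp : set_system E,
    bounded_wstar_net Fm m -> bounded_wstar_net Fn n ->
    bounded_wstar_net Fp p -> aron_berner_limit i Fm Fn Fp l].

Definition aron_berner_regular : Prop :=
  forall i j : 'I_6, aron_berner i = aron_berner j.

Definition separately_weakstar_continuous
    (s : bidual E -> bidual E -> bidual E -> bidual E) : Prop :=
  [/\ forall n p, weakstar_continuous (fun m => s m n p),
      forall m p, weakstar_continuous (fun n => s m n p)
    & forall m n, weakstar_continuous (fun p => s m n p)].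

End AronBerner.

(* Main.v *)
Require Import Defs.
From HB Require Import structures.
From mathcomp Require Import all_boot all_order all_algebra complex.
From mathcomp Require Import all_classical all_reals all_analysis.
From mathcomp Require Import ring lra.

Set Implicit Arguments.
Unset Strict Implicit.
Unset Printing Implicit Defensive.

Import Order.TTheory GRing.Theory Num.Theory.
Import numFieldNormedType.Exports.

Local Open Scope classical_set_scope.
Local Open Scope ring_scope.

(** Write P for the extension pi^0, J for the canonical embedding of E, D for
    P(Je,Je,_) and Q for P(Je,_,Je), where e is a tripotent of E.

    P is an iterated Arens adjoint ([arens], [aron_berner0E]). As such it is
    weak-star continuous in its first variable, and in its middle variable when
    the first one lies in E; by symmetry it is also continuous in the third
    variable, and in the middle one as soon as one outer variable lies in E.
    That the iterated limits determine P, and that identities between weak-star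
    continuous maps may be checked on E, both rest on Goldstine's theorem
    ([goldstine]), proved here by separating the point (m f_1, ..., m f_k) from
    the convex image of a ball of E by means of a near-nearest point.

    By density the Jordan identity extends to the bidual, one variable at a time
    in a suitable order ([extended_jordan]). It expresses P(c, P(b,x,d), e) by
    terms in which x is an outer variable, so this map is weak-star continuous in
    x ([quad_comp_continuous]); with b = d and c = e it is (i).

    For (ii), Peirce calculus shows that P(m,x,n) = P(m,QQx,n) when m and n lie
    in the Peirce 2-space of e ([peirce2_quad]). The right-hand side is the map
    of the previous paragraph composed with Q, and Q is continuous because e lies
    in E.

    For (iii), (ii) gives the continuity of x |-> P(m,x,m) for every m, and
    polarization gives that of x |-> P(m,x,n). A separately continuous P can be
    computed by iterated limits in any order, which is regularity
    ([separately_continuous_regular]). For (iv), P(Ju,Ju,x) = x holds on E, hence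
    everywhere by density, so that (iii) applies with e = u. *)

(** * Bounded functionals *)

Section BoundedFunctionals.
Variables (R : realType) (V : normedModType R[i]).

Lemma bounded_linear_functional (phi : V -> R[i]^o) (M : R[i]) :
  linear phi -> (forall x, `|phi x| <= M * `|x|) ->
  phi \in @continuous_functional R V.
Proof.
move=> lphi bphi; rewrite inE; split=> //.
pose lin := GRing.isLinear.Build R[i] V R[i]^o _ phi lphi.
pose phil : {linear V -> R[i]^o} := HB.pack phi lin.
apply/(@linear_bounded_continuous _ _ _ phil)/bounded_funP => r.
exists (`|M| * `|r|) => x xr.
have M0 : M * `|x| \is Num.real by rewrite ger0_real// (le_trans _ (bphi x)).
apply: (le_trans (bphi x)); apply: (le_trans (real_ler_norm M0)).
rewrite normrM normr_id ler_wpM2l// (le_trans xr)// real_ler_norm//.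
by rewrite ger0_real// (le_trans _ xr).
Qed.

(** The defining property is packed in an opaque witness so that distinct
    functionals are never compared by unfolding their definitions. *)
Lemma functional_exists : {F : (V -> R[i]) -> dual V |
  forall phi (M : R[i]), linear (phi : V -> R[i]^o) ->
    (forall x, `|phi x| <= M * `|x|) -> forall x, F phi x = phi x}.
Proof.
exists (fun phi => insubd (0 : dual V) (phi : V -> R[i]^o)) => phi M lphi bphi x.
have := insubdK (0 : dual V) (bounded_linear_functional lphi bphi).
by move=> /(congr1 (fun h => h x)).
Qed.

Definition functional : (V -> R[i]) -> dual V := sval functional_exists.

Lemma functionalE (phi : V -> R[i]) (M : R[i]) :
  linear (phi : V -> R[i]^o) -> (forall x, `|phi x| <= M * `|x|) ->
  forall x, functional phi x = phi x.
Proof. exact: (svalP functional_exists). Qed.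

Lemma dual_norm_bound (g : dual V) (M : R[i]) : 0 <= M ->
  (forall x, `|g x| <= M * `|x|) -> `|g| <= M.
Proof.
move=> M0 gM; rewrite -(ReK_ge0 M0) lecR.
by apply: opnorm_le; [rewrite -ler0c ReK_ge0|rewrite ReK_ge0].
Qed.

Lemma functional_spec (phi : V -> R[i]) (M : R[i]) :
  0 <= M -> (forall k u v, phi (k *: u + v) = k * phi u + phi v) ->
  (forall x, `|phi x| <= M * `|x|) ->
  (forall x, functional phi x = phi x) /\ `|functional phi| <= M.
Proof.
move=> M0 lphi bphi.
have phiE x : functional phi x = phi x by rewrite (functionalE lphi bphi).
by split=> //; apply: dual_norm_bound => // x; rewrite phiE; exact: bphi.
Qed.

End BoundedFunctionals.

(** The real part of a functional already controls its norm: a vector [x] can be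
    multiplied by a scalar that makes [g x] real and nonnegative. *)
Lemma dual_norm_le_Re (R : realType) (V : normedModType R[i]) (g : dual V)
    (r a : R) :
  0 < r -> (forall x : V, `|x| <= r%:C%C -> complex.Re (g x) <= a) ->
  r%:C%C * `|g| <= a%:C%C.
Proof.
move=> r0 ga.
have rC0 : 0 < r%:C%C :> R[i] by rewrite ltcR.
have a0 : 0 <= a.
  by have := ga 0; rewrite normr0 linear0; apply; rewrite ltW.
rewrite -ler_pdivlMl//.
apply: dual_norm_bound; first by rewrite mulr_ge0// ?invr_ge0 ?ler0c// ltW.
move=> x.
have [gx0|gx0] := eqVneq (g x) 0.
  by rewrite gx0 normr0 mulr_ge0// mulr_ge0// ?invr_ge0 ?ler0c// ltW.
have x0 : x != 0 by apply: contra_neq gx0 => ->; rewrite linear0.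
have nx0 : `|x| != 0 by rewrite normr_eq0.
(* [k] rotates [g x] onto the positive axis and brings [x] to the sphere of
   radius [r]. *)
pose k : R[i] := r%:C%C / `|x| * ((g x)^* / `|g x|).
have gk : g (k *: x) = r%:C%C / `|x| * `|g x|.
  rewrite linearZ/= -[LHS]/(k * g x) /k -mulrA; congr (_ * _).
  by rewrite mulrAC -normCKC expr2 mulfK// normr_eq0.
have nk : `|k *: x| <= r%:C%C.
  rewrite normrZ /k !normrM !normfV !normr_id norm_conjC divff ?normr_eq0//.
  by rewrite mulr1 divfK// ger0_norm// ltW.
have := ga _ nk; rewrite -lecR gk ReK_ge0; last first.
  by rewrite !mulr_ge0// ?invr_ge0// ltW.
by rewrite mulrAC ler_pdivrMr ?normr_gt0// -ler_pdivlMl// mulrA.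
Qed.

(** Moving from [c] towards [x] by the proportion [a] changes a quadratic
    function [D] into [D + 2 a (I - D) + S]; near a minimum [d] this forces the
    inner product [I] to be at least [d / 2]. *)
Lemma segment_step (R : realFieldType) (a d D I S : R) : 0 < a * d ->
  d <= D + (a * (2 * I) - a * (2 * D)) + S -> S <= a * (d / 4) ->
  D < d + a * d / 2 -> a * d <= a * D -> a * (d / 2) <= a * I.
Proof. lra. Qed.

(** * Weak-star density of the canonical image *)

Section Goldstine.
Variables (R : realType) (E : normedModType R[i]).

(** The inner product of the complex plane seen as a real Euclidean plane. *)
Definition re_dot (z w : R[i]) : R :=
  complex.Re z * complex.Re w + complex.Im z * complex.Im w.

Lemma re_dot_sqr (z : R[i]) : (re_dot z z)%:C%C = `|z| ^+ 2.
Proof. by rewrite -add_Re2_Im2. Qed.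

Lemma re_dot_ge0 (z : R[i]) : 0 <= re_dot z z.
Proof. by rewrite addr_ge0// -expr2 sqr_ge0. Qed.

Lemma re_dotE (z w : R[i]) : re_dot z w = complex.Re (z^* * w).
Proof. by case: z w => [a b] [c d]; rewrite /re_dot /=; ring. Qed.

Lemma re_dot_segment (z w : R[i]) (s : R) :
  re_dot (z + s%:C%C * (w - z)) (z + s%:C%C * (w - z)) =
  re_dot z z + s * (2 * (re_dot z w - re_dot z z)) +
  s ^+ 2 * re_dot (w - z) (w - z).
Proof. by case: z w => [a b] [c d]; rewrite /re_dot /=; ring. Qed.

Variables (m : bidual E) (s : seq (dual E)).

Let r : R := complex.Re `|m| + 1.

Let defect (x : E) : R := \sum_(f <- s) re_dot (m f - f x) (m f - f x).

Let r_gt0 : 0 < r.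
Proof. by rewrite ltr_wpDl// -ler0c ReK_ge0. Qed.

Let rE : r%:C%C = `|m| + 1 :> R[i].
Proof. by rewrite /r rmorphD rmorph1; congr (_ + _); exact: ReK_ge0. Qed.

(** The variational inequality of the projection onto a convex set, for
    near-minimizers only, since the infimum of [defect] on the ball need not be
    attained. Let [c] be a near-minimizer and [x] a point of the ball. Going from
    [c] towards [x] cannot lower [defect] below [d], and the second order term is
    negligible for a small step because the ball is bounded; so the derivative at
    [c] cannot be very negative. *)
Lemma defect_variational (d : R) : 0 < d ->
  (forall x, `|x| <= `|m| + 1 -> d <= defect x) ->
  exists2 eta : R, 0 < eta & forall c x, `|c| <= `|m| + 1 -> `|x| <= `|m| + 1 ->
    defect c < d + eta ->
    d / 2 <= \sum_(f <- s) re_dot (m f - f c) (m f - f x).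
Proof.
move=> d0 dmin.
have [K [K0 dK sumK]] : exists K : R, [/\ 0 < K, d <= K & forall c x,
    `|c| <= `|m| + 1 -> `|x| <= `|m| + 1 ->
    \sum_(f <- s) re_dot (f c - f x) (f c - f x) <= K].
  exists (\sum_(f <- s) (complex.Re `|f| * (2 * r)) ^+ 2 + d); split.
  - by rewrite ltr_wpDl// sumr_ge0// => f _; rewrite sqr_ge0.
  - by rewrite lerDr sumr_ge0// => f _; rewrite sqr_ge0.
  move=> c x cr xr; rewrite ler_wpDr ?(ltW d0)//; apply: ler_sum => f _.
  have fr : ((complex.Re `|f| * (2 * r)) ^+ 2)%:C%C =
      (`|f| * (2 * (`|m| + 1))) ^+ 2.
    rewrite -rE -[X in _ = (X * _) ^+ _](ReK_ge0 (normr_ge0 f)).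
    by rewrite rmorphXn !rmorphM rmorph_nat.
  rewrite -lecR re_dot_sqr fr lerXn2r ?nnegrE ?mulr_ge0 ?addr_ge0//.
  rewrite -linearB (le_trans (le_dual_norm _ _))// ler_wpM2l//.
  rewrite (le_trans (ler_normB _ _))// mulr_natl mulr2n.
  exact: lerD.
(* This step makes the second order term [a ^+ 2 * K] at most a quarter of
   [a * d]. *)
pose a : R := d / (4 * K).
have a0 : 0 < a by rewrite divr_gt0// mulr_gt0.
have a1 : a <= 1.
  by rewrite ler_pdivrMr ?mulr_gt0//; lra.
have aK : a * K = d / 4.
  by rewrite /a; field; rewrite gt_eqF.
exists (a * d / 2) => [|c x cr xr cmin]; first by rewrite divr_gt0// mulr_gt0.
set IP := \sum_(f <- s) _.
have yr : `|c + a%:C%C *: (x - c)| <= `|m| + 1.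
  have -> : c + a%:C%C *: (x - c) = (1 - a)%:C%C *: c + a%:C%C *: x.
    by rewrite rmorphB/= scalerBl scale1r scalerBr addrA addrAC.
  rewrite (le_trans (ler_normD _ _))// !normrZ.
  rewrite !ger0_norm ?lecR ?ler0c ?subr_ge0 ?(ltW a0)//.
  apply: (@le_trans _ _ ((1 - a)%:C%C * (`|m| + 1) + a%:C%C * (`|m| + 1))).
    by rewrite lerD// ler_wpM2l// ler0c ?subr_ge0// ltW.
  by rewrite -mulrDl -rmorphD/= subrK mul1r.
have defectE : defect (c + a%:C%C *: (x - c)) =
    defect c + a * (2 * (IP - defect c)) +
    a ^+ 2 * \sum_(f <- s) re_dot (f c - f x) (f c - f x).
  rewrite /defect /IP -sumrB !mulr_sumr -!big_split/=; apply: eq_bigr => f _.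
  have -> : m f - f (c + a%:C%C *: (x - c)) =
      (m f - f c) + a%:C%C * ((m f - f x) - (m f - f c)).
    rewrite linearD linearZ linearB/= -[_ *: _]/(a%:C%C * (f x - f c)); ring.
  by rewrite re_dot_segment; congr (_ + _ * re_dot _ _); ring.
have := dmin _ yr; rewrite defectE => le1.
have dc := dmin _ cr.
have le2 : a ^+ 2 * \sum_(f <- s) re_dot (f c - f x) (f c - f x) <= a * (d / 4).
  by rewrite -aK mulrA -expr2 ler_wpM2l ?sqr_ge0 ?sumK.
rewrite -(ler_pM2l a0).
have : a * d <= a * defect c by rewrite ler_wpM2l// ltW.
move: le1 le2 cmin; rewrite !(mulrBr, mulrDr).
exact: segment_step (mulr_gt0 a0 d0).
Qed.

(** Otherwise the infimum of [defect] on the ball is positive, and a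
    near-minimizer [c] yields a functional [g], a combination of the members of
    [s], whose real part on the ball stays below [Re (m g)] by a fixed amount.
    The radius of the ball is at least the norm of [m], so this contradicts
    [|m g| <= |m| |g|]. *)
Lemma helly_ball (eps : R) : 0 < eps ->
  exists2 x : E, `|x| <= `|m| + 1 &
    forall f, f \in s -> `|m f - f x| < eps%:C%C.
Proof.
move=> eps0.
have [[x xr xeps]|nox] :=
  pselect (exists2 x, `|x| <= `|m| + 1 & defect x < eps ^+ 2).
  exists x => // f fs; rewrite -(ltr_pXn2r (n := 2)) ?nnegrE ?normr_ge0//;
    last by rewrite ler0c ltW.
  rewrite -re_dot_sqr -rmorphXn ltcR (le_lt_trans _ xeps)//.
  rewrite /defect (big_rem f)//= lerDl sumr_ge0// => g _; exact: re_dot_ge0.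
exfalso.
pose S := [set defect x | x in [set x : E | `|x| <= `|m| + 1]].
have S0 : S !=set0 by exists (defect 0), 0 => //=; rewrite normr0 addr_ge0.
have Slb : lbound S (eps ^+ 2).
  by move=> _ [y yr <-]; rewrite leNgt; apply/negP => ?; apply: nox; exists y.
have dpos : 0 < inf S.
  by rewrite (lt_le_trans _ (lb_le_inf S0 Slb))// exprn_gt0.
have Sinf : has_inf S by split => //; exists (eps ^+ 2).
have dmin x : `|x| <= `|m| + 1 -> inf S <= defect x.
  by move=> xr; apply: ge_inf; [exact: Sinf.2|exists x].
have [eta eta0 etaP] := defect_variational dpos dmin.
have [_ [c cr <-] cS] := inf_adherent eta0 Sinf.
pose g : dual E := \sum_(f <- s) (m f - f c)^* *: f.
have gE x : \sum_(f <- s) re_dot (m f - f c) (m f - f x) = complex.Re (m g - g x).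
  have gx : g x = \sum_(f <- s) (m f - f c)^* * f x.
    by rewrite -[g x]/(canonical_embedding x g) linear_sum.
  rewrite gx linear_sum/= -sumrB.
  rewrite (raddf_sum (@complex.Re R : Rcomplex R -> R))/=; apply: eq_bigr => f _.
  by rewrite re_dotE linearZ/= mulrBr.
have gx x : `|x| <= r%:C%C -> complex.Re (g x) <= complex.Re (m g) - inf S / 2.
  rewrite rE => xr; have := etaP c x cr xr cS; rewrite gE.
  rewrite [complex.Re _](raddfB (@complex.Re R : Rcomplex R -> R)).
  by rewrite lerBrDr => ?; rewrite lerBrDr addrC.
have := dual_norm_le_Re r_gt0 gx; rewrite rE => le1.
have le2 : `|m g| <= (complex.Re (m g) - inf S / 2)%:C%C.
  rewrite (le_trans _ le1)// (le_trans (le_dual_norm _ _))// ler_wpM2r//.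
  by rewrite lerDl.
have := le_trans (normc_ge_Re (m g)) le2; rewrite lecR => le3.
have := le_trans (ler_norm _) le3.
by rewrite lerBrDr gerDl leNgt divr_gt0.
Qed.

End Goldstine.

Section WeakStarDensity.
Variables (R : realType) (E : normedModType R[i]).

(** The filter generated by the traces on a ball of [E] of the basic weak-star
    neighbourhoods of [m]. *)
Definition goldstine_net (m : bidual E) : set_system E :=
  [set A | exists (s : seq (dual E)) (eps : R), 0 < eps /\
    forall x, `|x| <= `|m| + 1 ->
      (forall f, f \in s -> `|m f - f x| < eps%:C%C) -> A x].

Lemma goldstine_net_proper (m : bidual E) : ProperFilter (goldstine_net m).
Proof.
split.
  move=> [s [e [e0 h]]]; have [x xm xs] := helly_ball m s e0; exact: (h x).
split.
- by exists [::], 1; split.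
- move=> A B [s [e [e0 sA]]] [s' [e' [e'0 sB]]].
  exists (s ++ s'), (Order.min e e'); split; first by rewrite lt_min e0.
  move=> x xm xs; split; [apply: sA|apply: sB] => // f fs.
    by rewrite (lt_le_trans (xs f _)) ?mem_cat ?fs// lecR ge_min lexx.
  by rewrite (lt_le_trans (xs f _)) ?mem_cat ?fs ?orbT// lecR ge_min lexx orbT.
- move=> A B AB [s [e [e0 sA]]]; exists s, e; split => // x xm xs.
  exact/AB/sA.
Qed.

Lemma goldstine (m : bidual E) : bounded_wstar_net (goldstine_net m) m.
Proof.
have mF := goldstine_net_proper m.
split => //.
  apply/ex_bound; exists (`|m| + 1).
  by exists [::], 1; split => // x xm _.
apply/weakstar_cvgP => f; apply/cvgrPdist_lt => e e0.
have [e' e'0 ->] : exists2 e' : R, 0 < e' & e = e'%:C%C.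
  have eE := ReK_ge0 (ltW e0).
  by exists (complex.Re e); rewrite -?ltcR eE.
rewrite near_simpl; exists [:: f], e'; split => // x _ /(_ f).
by apply; rewrite mem_head.
Qed.

Lemma weakstar_continuousP (S : dual E -> dual E) :
  weakstar_continuous S <-> forall x, continuous (fun g : weakstar E => S g x).
Proof.
split=> [cS x g|cS g].
  by have /(weakstar_cvgP _ (fmap_filter _ _))/(_ x) := cS g.
by apply/(weakstar_cvgP _ (fmap_filter _ (nbhs_filter _))) => x; exact: cS.
Qed.

End WeakStarDensity.

Section Density.
Variables (R : realType) (E : normedModType R[i]).
Local Notation J := (@canonical_embedding R E).

Lemma weakstar_unique (V : normedModType R[i]) (T : Type) (F : set_system T)
    (h : T -> weakstar V) (g1 g2 : dual V) : ProperFilter F ->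
  h x @[x --> F] --> (g1 : weakstar V) -> h x @[x --> F] --> (g2 : weakstar V) ->
  g1 = g2.
Proof.
move=> FF /weakstar_cvgP h1 /weakstar_cvgP h2; apply: dual_ext => x.
apply: (cvg_unique _ (h1 x) (h2 x)); exact: norm_hausdorff.
Qed.

(** The way in which every identity passes from [E] to its bidual, one variable
    at a time. *)
Lemma weakstar_dense (S T : bidual E -> bidual E) :
  weakstar_continuous S -> weakstar_continuous T ->
  (forall x, S (J x) = T (J x)) -> forall m, S m = T m.
Proof.
move=> cS cT ST m; have [FF _ Fm] := goldstine m.
have SJ : S \o J = T \o J by apply/funext => x; exact: ST.
have Sm : (S \o J) x @[x --> goldstine_net m] --> (S m : weakstar (dual E)).
  exact: cvg_comp Fm (cS m).
apply: (weakstar_unique FF Sm); rewrite SJ; exact: cvg_comp Fm (cT m).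
Qed.

End Density.

(** * The extension as an iterated adjoint *)

Section ArensExtension.
Variables (R : realType) (E : normedModType R[i]).
Local Notation J := (@canonical_embedding R E).

Variables (t : E -> E -> E -> E) (tJ : jordan_triple_product t).

Let tl k a a' b c : t (k *: a + a') b c = k *: t a b c + t a' b c.
Proof. exact: (triple_linearl tJ). Qed.

Let tr k a b c c' : t a b (k *: c + c') = k *: t a b c + t a b c'.
Proof. exact: (triple_linearr tJ). Qed.

Let tm k a b b' c : t a (k *: b + b') c = k^* *: t a b c + t a b' c.
Proof. exact: (triple_conj_linear tJ). Qed.

Lemma triple0l b c : t 0 b c = 0.
Proof. by have := tl (-1) 0 0 b c; rewrite scaler0 addr0 scaleN1r addNr. Qed.

Lemma triple0r a b : t a b 0 = 0.
Proof. by rewrite (triple_sym tJ) triple0l. Qed.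

Lemma triple0m a c : t a 0 c = 0.
Proof.
by have := tm (-1) a 0 0 c; rewrite scaler0 addr0 rmorphN1 scaleN1r addNr.
Qed.

Lemma tripleZ k l h a b c :
  t (k *: a) (l *: b) (h *: c) = (k * l^* * h) *: t a b c.
Proof.
have := tl k a 0 (l *: b) (h *: c); rewrite addr0 triple0l addr0 => ->.
have := tm l a b 0 (h *: c); rewrite addr0 triple0m addr0 => ->.
have := tr h a b c 0; rewrite addr0 triple0r addr0 => ->.
by rewrite !scalerA.
Qed.

(** Continuity at the origin bounds [t] on a small ball, and homogeneity does
    the rest. *)
Lemma triple_bounded : exists2 K : R[i], 0 <= K &
  forall a b c, `|t a b c| <= K * `|a| * `|b| * `|c|.
Proof.
have := @triple_continuous _ _ _ tJ (0, 0, 0).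
rewrite /continuous_at /= triple0l => t0.
have n0 : `|0 : E| < 1 by rewrite normr0.
have /nbhs_ballP[e /= e0 te] := cvgr_norm_lt (FF := nbhs_filter _) _ t0 _ n0.
have [d d0 de] : exists2 d : R[i], 0 < d & d < e.
  by exists (e / 2); rewrite ?divr_gt0// ltr_pdivrMr// ltr_pMr// ltr1n.
have tlt1 a b c : `|a| < e -> `|b| < e -> `|c| < e -> `|t a b c| < 1.
  move=> ae be ce; apply: (te ((a, b), c)).
  by split; [split|]; rewrite -ball_normE/= sub0r normrN.
have K0 : 0 <= (d * d * d)^-1 by rewrite invr_ge0 !mulr_ge0 ?ltW.
exists (d * d * d)^-1 => // a b c.
have [->|a0] := eqVneq a 0; first by rewrite triple0l normr0 !mulr_ge0.
have [->|b0] := eqVneq b 0; first by rewrite triple0m normr0 !mulr_ge0.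
have [->|c0] := eqVneq c 0; first by rewrite triple0r normr0 !mulr_ge0.
have scaled (x : E) : x != 0 -> `|(d / `|x|) *: x| < e.
  move=> x0; rewrite normrZ normrM normfV normr_id divfK ?normr_eq0//.
  by rewrite gtr0_norm.
have := tlt1 _ _ _ (scaled _ a0) (scaled _ b0) (scaled _ c0).
rewrite tripleZ normrZ !normrM !normfV norm_conjC !normrM !normfV !normr_id.
rewrite (gtr0_norm d0) => /ltW.
have na : 0 < `|a| by rewrite normr_gt0.
have nb : 0 < `|b| by rewrite normr_gt0.
have nc : 0 < `|c| by rewrite normr_gt0.
have -> : d / `|a| * (d / `|b|) * (d / `|c|) * `|t a b c| =
  d * d * d * `|t a b c| / (`|a| * `|b| * `|c|) by field; rewrite !gt_eqF.
rewrite ler_pdivrMr ?mulr_gt0// mul1r => le1.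
by rewrite -!mulrA ler_pdivlMl ?mulr_gt0// !mulrA.
Qed.

(** The functionals [slice3], [slice2] and [slice1] are the Arens adjoints of
    [t], taken in the third, second and first variable. The conjugation in
    [slice2] makes it linear, since [t] is conjugate linear in its middle
    variable; the one in [slice1] then makes it linear in [x] again. *)
Definition slice3 (x y : E) (f : dual E) : dual E :=
  functional (fun z => f (t x y z)).

Definition slice2 (p : bidual E) (x : E) (f : dual E) : dual E :=
  functional (fun y => (p (slice3 x y f))^*).

Definition slice1 (n p : bidual E) (f : dual E) : dual E :=
  functional (fun x => (n (slice2 p x f))^*).

Definition arens (m n p : bidual E) : bidual E :=
  functional (fun f => m (slice1 n p f)).

(** Each slice is the evaluation of an element of the bidual at the previous
    slice, so the bounds must be carried along to know that the next one is
    bounded. *)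
Let slice_spec : exists2 K : R[i], 0 <= K &
  [/\ forall x y f, (forall z, slice3 x y f z = f (t x y z)) /\
        `|slice3 x y f| <= K * `|f| * `|x| * `|y|,
      forall p x f, (forall y, slice2 p x f y = (p (slice3 x y f))^*) /\
        `|slice2 p x f| <= `|p| * (K * `|f| * `|x|),
      forall n p f, (forall x, slice1 n p f x = (n (slice2 p x f))^*) /\
        `|slice1 n p f| <= `|n| * (`|p| * (K * `|f|))
    & forall m n p f, arens m n p f = m (slice1 n p f)].
Proof.
have [K K0 tK] := triple_bounded; exists K => //.
have s3 x y f : (forall z, slice3 x y f z = f (t x y z)) /\
        `|slice3 x y f| <= K * `|f| * `|x| * `|y|.
  apply: functional_spec => [|k u v|z]; first by rewrite !mulr_ge0.
    by rewrite tr linearD linearZ.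
  rewrite (le_trans (le_dual_norm _ _))//.
  by rewrite [K * _]mulrC -!mulrA ler_wpM2l// !mulrA.
have s3E x y f z : slice3 x y f z = f (t x y z) by have [] := s3 x y f.
have s2 p x f : (forall y, slice2 p x f y = (p (slice3 x y f))^*) /\
        `|slice2 p x f| <= `|p| * (K * `|f| * `|x|).
  apply: functional_spec => [|k u v|y]; first by rewrite !mulr_ge0.
    have -> : slice3 x (k *: u + v) f = k^* *: slice3 x u f + slice3 x v f.
      apply: dual_ext => z.
      rewrite [RHS](_ : _ = k^* * slice3 x u f z + slice3 x v f z)//.
      by rewrite !s3E tm linearD linearZ.
    by rewrite linearD linearZ/= rmorphD rmorphM/= conjCK.
  rewrite norm_conjC (le_trans (le_dual_norm _ _))//.
  by rewrite -[leRHS]mulrA ler_wpM2l//; exact: (s3 _ _ _).2.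
have s2E p x f y : slice2 p x f y = (p (slice3 x y f))^* by have [] := s2 p x f.
have s1 n p f : (forall x, slice1 n p f x = (n (slice2 p x f))^*) /\
        `|slice1 n p f| <= `|n| * (`|p| * (K * `|f|)).
  apply: functional_spec => [|k u v|x]; first by rewrite !mulr_ge0.
    have -> : slice2 p (k *: u + v) f = k^* *: slice2 p u f + slice2 p v f.
      apply: dual_ext => y.
      rewrite [RHS](_ : _ = k^* * slice2 p u f y + slice2 p v f y)//.
      rewrite !s2E -rmorphM -rmorphD; congr (_^*).
      have -> : slice3 (k *: u + v) y f = k *: slice3 u y f + slice3 v y f.
        apply: dual_ext => z.
        rewrite [RHS](_ : _ = k * slice3 u y f z + slice3 v y f z)//.
        by rewrite !s3E tl linearD linearZ.
      by rewrite linearD linearZ.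
    by rewrite linearD linearZ/= rmorphD rmorphM/= conjCK.
  rewrite norm_conjC (le_trans (le_dual_norm _ _))//.
  rewrite -[leRHS]mulrA ler_wpM2l// (le_trans (s2 _ _ _).2)//.
  by rewrite !mulrA.
have s1E n p f x : slice1 n p f x = (n (slice2 p x f))^* by have [] := s1 n p f.
split=> // m n p f.
have [|k u v|g|-> //] := @functional_spec R (dual E) (fun f => m (slice1 n p f))
    (`|m| * (`|n| * (`|p| * K))).
- by rewrite !mulr_ge0.
- have -> : slice1 n p (k *: u + v) = k *: slice1 n p u + slice1 n p v.
    apply: dual_ext => x.
    rewrite [RHS](_ : _ = k * slice1 n p u x + slice1 n p v x)//.
    rewrite !s1E -[k in RHS]conjCK -rmorphM -rmorphD; congr (_^*).
    have -> : slice2 p x (k *: u + v) = k^* *: slice2 p x u + slice2 p x v.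
      apply: dual_ext => y.
      rewrite [RHS](_ : _ = k^* * slice2 p x u y + slice2 p x v y)//.
      rewrite !s2E -rmorphM -rmorphD; congr (_^*).
      have -> : slice3 x y (k *: u + v) = k *: slice3 x y u + slice3 x y v.
        apply: dual_ext => z.
        rewrite [RHS](_ : _ = k * slice3 x y u z + slice3 x y v z)//.
        by rewrite !s3E.
      by rewrite linearD linearZ.
    by rewrite linearD linearZ.
  by rewrite linearD linearZ.
- rewrite (le_trans (le_dual_norm _ _))// -[leRHS]mulrA ler_wpM2l//.
  by rewrite (le_trans (s1 _ _ _).2)// !mulrA.
Qed.

Lemma slice3E x y f z : slice3 x y f z = f (t x y z).
Proof. by have [K _ [s _ _ _]] := slice_spec; have [-> _] := s x y f. Qed.

Lemma slice2E p x f y : slice2 p x f y = (p (slice3 x y f))^*.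
Proof. by have [K _ [_ s _ _]] := slice_spec; have [-> _] := s p x f. Qed.

Lemma slice1E n p f x : slice1 n p f x = (n (slice2 p x f))^*.
Proof. by have [K _ [_ _ s _]] := slice_spec; have [-> _] := s n p f. Qed.

Lemma arensE m n p f : arens m n p f = m (slice1 n p f).
Proof. by have [K _ [_ _ _ ->]] := slice_spec. Qed.

Lemma arensJl x n p f : arens (J x) n p f = (n (slice2 p x f))^*.
Proof. by rewrite arensE -slice1E. Qed.

Lemma arensJlm x y p f : arens (J x) (J y) p f = p (slice3 x y f).
Proof. by rewrite arensJl/= slice2E conjCK. Qed.

Lemma arensJ x y z : arens (J x) (J y) (J z) = J (t x y z).
Proof. by apply: dual_ext => f; rewrite arensJlm/= slice3E. Qed.

Lemma arensDl m m' n p : arens (m + m') n p = arens m n p + arens m' n p.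
Proof.
apply: dual_ext => f; rewrite [RHS](_ : _ = arens m n p f + arens m' n p f)//.
by rewrite !arensE.
Qed.

Lemma eval_continuous (V : normedModType R[i]) (x : V) :
  continuous (fun g : weakstar V => (g : dual V) x).
Proof. exact: (weakstar_continuousP (fun g => g)).1 (fun g => cvg_id) x. Qed.

Lemma arens_continuousl n p : weakstar_continuous (fun m => arens m n p).
Proof.
apply/weakstar_continuousP => f; under eq_fun do rewrite arensE.
exact: eval_continuous.
Qed.

Lemma conj_continuous : continuous (fun z : R[i]^o => (z^* : R[i]^o)).
Proof.
move=> z; apply/(cvgrPdist_lt (FF := nbhs_filter z)) => e e0.
have /(cvgrPdist_lt (FF := nbhs_filter z))/(_ e e0) := @cvg_id _ (nbhs z).
by apply: filterS => w; rewrite -rmorphB norm_conjC.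
Qed.

Lemma arens_continuousm x p : weakstar_continuous (fun n => arens (J x) n p).
Proof.
apply/weakstar_continuousP => f; under eq_fun do rewrite arensJl.
move=> n; apply: (@continuous_comp _ _ _
  (fun n : weakstar (dual E) => (n : bidual E) (slice2 p x f) : R[i]^o)
  (fun z : R[i]^o => (z^* : R[i]^o))).
  exact: eval_continuous.
exact: conj_continuous.
Qed.

Lemma arens_continuousr x y : weakstar_continuous (arens (J x) (J y)).
Proof.
apply/weakstar_continuousP => f; under eq_fun do rewrite arensJlm.
exact: eval_continuous.
Qed.

End ArensExtension.

(** * The Jordan identity in the bidual *)

Section WeakStarOperators.
Variables (R : realType) (V : normedModType R[i]).
Implicit Types S T : dual V -> dual V.

Lemma weakstar_continuousD S T : weakstar_continuous S -> weakstar_continuous T ->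
  weakstar_continuous (fun x => S x + T x).
Proof.
move=> /weakstar_continuousP cS /weakstar_continuousP cT.
by apply/weakstar_continuousP => f g; exact: cvgD (cS f g) (cT f g).
Qed.

Lemma weakstar_continuousZ (k : R[i]) S : weakstar_continuous S ->
  weakstar_continuous (fun x => k *: S x).
Proof.
move=> /weakstar_continuousP cS; apply/weakstar_continuousP => f g.
exact: cvgZr (cS f g).
Qed.

Lemma weakstar_continuousB S T : weakstar_continuous S -> weakstar_continuous T ->
  weakstar_continuous (fun x => S x - T x).
Proof.
move=> cS /(weakstar_continuousZ (k := -1)) cT.
by under eq_fun do rewrite -scaleN1r; exact: weakstar_continuousD.
Qed.

Lemma weakstar_continuous_comp S T : weakstar_continuous S ->
  weakstar_continuous T -> weakstar_continuous (fun x => S (T x)).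
Proof. by move=> cS cT x; exact: continuous_comp (cT x) (cS (T x)). Qed.

Lemma weakstar_continuous_id : weakstar_continuous (fun x : dual V => x).
Proof. by move=> x; exact: cvg_id. Qed.

End WeakStarOperators.

Lemma dualDE (R : realType) (V : normedModType R[i]) (f g : dual V) x :
  (f + g) x = f x + g x :> R[i].
Proof. by []. Qed.

Lemma dualBE (R : realType) (V : normedModType R[i]) (f g : dual V) x :
  (f - g) x = f x - g x :> R[i].
Proof. by []. Qed.

Lemma canonical_embeddingD (R : realType) (V : normedModType R[i]) (x y : V) :
  canonical_embedding (x + y) = canonical_embedding x + canonical_embedding y.
Proof. by apply: dual_ext => f /=; rewrite linearD. Qed.

Lemma canonical_embeddingB (R : realType) (V : normedModType R[i]) (x y : V) :
  canonical_embedding (x - y) = canonical_embedding x - canonical_embedding y.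
Proof. by apply: dual_ext => f /=; rewrite linearB. Qed.

(** This lemma and the next are the scalar eliminations behind two vector
    identities of Peirce calculus; evaluating at a functional reduces the
    vectors to scalars, where they can be solved as linear systems. *)
Lemma tripotent_scalars (K : numFieldType) (a q r : K) :
  a = q - r + q -> q = a - r + a -> a = q.
Proof.
move=> aE qE; apply/eqP; rewrite -subr_eq0.
have -> : a - q = ((a - (q - r + q)) - (q - (a - r + a))) / 3 by field.
by rewrite -aE -qE !subrr mul0r.
Qed.

Lemma peirce2_scalars (K : numFieldType) (w1 w w2 s ds tau : K) :
  w1 = w - s + w -> w2 = w1 - ds + w1 -> ds = s - tau + s ->
  tau + tau = s -> w2 + w2 = w1 -> w1 = w.
Proof.
move=> e1 e2 e3 e4 e5; apply/eqP; rewrite -subr_eq0.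
have h1 : s = w + w - w1 by rewrite e1; ring.
have h2 : ds = w1 + w1 - w2 by rewrite {1}e2; ring.
have h3 : tau = s + s - ds by rewrite {1}e3; ring.
have -> : w1 - w = ((w2 + w2 - w1) - (tau + tau - s)) / 6.
  by rewrite h3 h2 h1; field.
by rewrite e4 e5 !subrr mul0r.
Qed.

(** The hypotheses on [P] are those that the first Aron-Berner extension
    satisfies once it is symmetric: weak-star continuity is assumed in an outer
    variable, but in the middle one only when an outer variable lies in [E]. *)
Section ExtendedTriple.
Variables (R : realType) (E : normedModType R[i]).
Variables (t : E -> E -> E -> E) (tJ : jordan_triple_product t).
Local Notation J := (@canonical_embedding R E).
Local Notation B := (bidual E).

Variable P : B -> B -> B -> B.
Hypothesis PE : forall x y z, P (J x) (J y) (J z) = J (t x y z).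
Hypothesis Psym : forall m n p, P m n p = P p n m.
Hypothesis Pl : forall n p, weakstar_continuous (fun m => P m n p).
Hypothesis Pm : forall x p, weakstar_continuous (fun n => P (J x) n p).
Hypothesis PDl : forall m m' n p, P (m + m') n p = P m n p + P m' n p.
Hypothesis PDm : forall m n n' p, P m (n + n') p = P m n p + P m n' p.

Let Pr m n : weakstar_continuous (P m n).
Proof. by rewrite (_ : P m n = (P^~ n)^~ m)//; apply/funext => p; rewrite Psym. Qed.

Let Pm' x p : weakstar_continuous (fun n => P p n (J x)).
Proof. by under eq_fun do rewrite Psym; exact: Pm. Qed.

(** The variables move from [E] to the bidual in the order [a], [b], [d], [c],
    [e]. The order matters: a middle variable is weak-star continuous only while
    one of its neighbours is still in [E], so [c] and [e] come last, and [a]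
    comes before [b] and [d] because it is a middle variable of [P b a d]. *)
Lemma extended_jordan a b c d e :
  P a b (P c d e) = P (P a b c) d e - P c (P b a d) e + P c d (P a b e).
Proof.
have st0 a' b' c' d' e' : P (J a') (J b') (P (J c') (J d') (J e')) =
    P (P (J a') (J b') (J c')) (J d') (J e')
    - P (J c') (P (J b') (J a') (J d')) (J e')
    + P (J c') (J d') (P (J a') (J b') (J e')).
  by rewrite !PE (triple_jordan tJ) canonical_embeddingD
    canonical_embeddingB.
have st1 b' c' d' e' : P a (J b') (P (J c') (J d') (J e')) =
    P (P a (J b') (J c')) (J d') (J e')
    - P (J c') (P (J b') a (J d')) (J e')
    + P (J c') (J d') (P a (J b') (J e')).
  move: a; apply: weakstar_dense => //.
  apply: weakstar_continuousD.
    apply: weakstar_continuousB.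
      exact: weakstar_continuous_comp (@Pl _ _) (@Pl _ _).
    exact: weakstar_continuous_comp (@Pm _ _) (@Pm _ _).
  exact: weakstar_continuous_comp (@Pr _ _) (@Pl _ _).
have st2 c' d' e' : P a b (P (J c') (J d') (J e')) =
    P (P a b (J c')) (J d') (J e')
    - P (J c') (P b a (J d')) (J e')
    + P (J c') (J d') (P a b (J e')).
  move: b; apply: weakstar_dense => //; first by rewrite PE.
  apply: weakstar_continuousD.
    apply: weakstar_continuousB.
      exact: weakstar_continuous_comp (@Pl _ _) (@Pm' _ _).
    exact: weakstar_continuous_comp (@Pm _ _) (@Pl _ _).
  exact: weakstar_continuous_comp (@Pr _ _) (@Pm' _ _).
have st3 c' e' : P a b (P (J c') d (J e')) =
    P (P a b (J c')) d (J e')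
    - P (J c') (P b a d) (J e')
    + P (J c') d (P a b (J e')).
  move: d; apply: weakstar_dense => //.
    exact: weakstar_continuous_comp (@Pr _ _) (@Pm _ _).
  apply: weakstar_continuousD => //.
  apply: weakstar_continuousB => //.
  exact: weakstar_continuous_comp (@Pm _ _) (@Pr _ _).
have st4 e' : P a b (P c d (J e')) =
    P (P a b c) d (J e') - P c (P b a d) (J e') + P c d (P a b (J e')).
  move: c; apply: weakstar_dense => //.
    exact: weakstar_continuous_comp (@Pr _ _) (@Pl _ _).
  apply: weakstar_continuousD => //.
  apply: weakstar_continuousB => //.
  exact: weakstar_continuous_comp (@Pl _ _) (@Pr _ _).
move: e; apply: weakstar_dense => //.
  exact: weakstar_continuous_comp (@Pr _ _) (@Pr _ _).
apply: weakstar_continuousD.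
  exact: weakstar_continuousB.
exact: weakstar_continuous_comp (@Pr _ _) (@Pr _ _).
Qed.

(** The term of the Jordan identity with the doubly nested middle variable is
    expressed by the three others, in which [x] occupies outer positions only.
    For [b = d] and [c = e] this is the formula
    Q(c)Q(b) = 2 D(c,b)^2 - D(Q(c)b,b). *)
Lemma quad_comp_continuous b c d e :
  weakstar_continuous (fun x => P c (P b x d) e).
Proof.
have -> : (fun x => P c (P b x d) e) =
    (fun x => P (P x b c) d e + P c d (P x b e) - P x b (P c d e)).
  apply/funext => x; have := extended_jordan x b c d e.
  by move=> ->; rewrite opprD opprB addrACA subrr addr0 addrC subrK.
apply: weakstar_continuousB => //; apply: weakstar_continuousD.
  exact: weakstar_continuous_comp (@Pl _ _) (@Pl _ _).
exact: weakstar_continuous_comp (@Pr _ _) (@Pl _ _).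
Qed.

Let PDr m n p p' : P m n (p + p') = P m n p + P m n p'.
Proof. by rewrite Psym PDl !(Psym _ n m). Qed.

(** * Peirce calculus of a tripotent of the original space *)

Section Tripotent.
Variable e : E.
Hypothesis etrip : P (J e) (J e) (J e) = J e.
Local Notation D := (P (J e) (J e)).
Local Notation Q x := (P (J e) x (J e)).

Let PBm m n n' p : P m (n - n') p = P m n p - P m n' p.
Proof. by apply/eqP; rewrite eq_sym subr_eq -PDm subrK. Qed.

Let PBr m n p p' : P m n (p - p') = P m n p - P m n p'.
Proof. by apply/eqP; rewrite eq_sym subr_eq -PDr subrK. Qed.

(** Expanding [D (Q x)] as a derivation gives DQ + QD = 2Q, and expanding
    [P (J e) x (P (J e) (J e) (J e))] gives Q = 2DQ - QD; hence the two. *)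
Lemma tripotent_DQ_QD x : D (Q x) = Q x /\ Q (D x) = Q x.
Proof.
have := extended_jordan (J e) (J e) (J e) x (J e).
have := extended_jordan (J e) x (J e) (J e) (J e).
rewrite !etrip (Psym x) (Psym (Q x)).
move: (Q x) (Q (D x)) (D (Q x)) => q r a qE aE.
have aq : a = q.
  apply: dual_ext => f; apply: (@tripotent_scalars R[i] (a f) (q f) (r f)).
    by rewrite {1}aE dualDE dualBE.
  by rewrite {1}qE dualDE dualBE.
split=> //; move: aE; rewrite aq => /eqP; rewrite addrAC eq_sym subr_eq => /eqP.
by move=> /addrI ->.
Qed.

Lemma tripotent_QQ x : Q (Q x) = D (D x) + D (D x) - D x.
Proof.
have := extended_jordan x (J e) (J e) (J e) (J e).
rewrite !etrip (Psym x) (Psym (D x)).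
move: (D x) (D (D x)) (Q (Q x)) => d dd q ->.
by rewrite [X in _ - X]addrAC opprB addrC subrK.
Qed.

(** [Q^2] is the projection onto the Peirce 2-space. For [T = P m _ n] with
    [m] and [n] in that space, the derivation property of [D] reads
    DT + TD = 2T; this expresses the Peirce rule that [T] sends the
    eigenspace of [D] for the eigenvalue t into that for 2 - t. On
    [z = x - Q^2 x] the operator [D] has eigenvalues 0 and 1/2 only, while 2 and
    3/2 are not eigenvalues of [D]; so [T z = 0]. The proof runs this argument
    without decomposing [z], through the quadratic relation satisfied by [D]. *)
Lemma peirce2_quad m n x : D m = m -> D n = n -> P m (Q (Q x)) n = P m x n.
Proof.
move=> Dm Dn.
have TD v : D (P m v n) = P m v n - P m (D v) n + P m v n.
  by rewrite extended_jordan Dm Dn.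
have DQ v : D (Q v) = Q v by have [] := tripotent_DQ_QD v.
have QD v : Q (D v) = Q v by have [] := tripotent_DQ_QD v.
have QQTD v : Q (Q (P m (D v) n)) = Q (Q (P m v n)).
  have := congr1 (fun g => Q (Q g)) (TD v).
  rewrite /= QD PDm PBm PDm PBm => /eqP.
  by rewrite -subr_eq0 opprD addrCA subrr addr0 oppr_eq0 subr_eq0 => /eqP.
pose z := x - Q (Q x); pose w := P m z n.
suff w0 : w = 0 by apply/esym/eqP; rewrite -subr_eq0 -PBm; exact/eqP.
have QQz : Q (Q z) = 0.
  by rewrite /z 2!PBm (tripotent_QQ (Q (Q x))) !DQ addrK subrr.
have DDz : D (D z) + D (D z) = D z.
  by apply/eqP; rewrite -subr_eq0 -tripotent_QQ QQz.
have TDDz : P m (D (D z)) n + P m (D (D z)) n = P m (D z) n by rewrite -PDm DDz.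
have QQw : Q (Q w) = 0.
  have := congr1 (fun g => Q (Q g)) TDDz.
  by rewrite !PDm !QQTD -/w => /eqP; rewrite -subr_eq0 addrK => /eqP.
have DDw : D (D w) + D (D w) = D w.
  by apply/eqP; rewrite -subr_eq0 -tripotent_QQ QQw.
have Dw : D w = w.
  have := TD z; have := TD (D z); move: TDDz; rewrite -/w.
  set s := P m (D z) n; set tau := P m (D (D z)) n => tauE DsE DwE.
  have DDwE : D (D w) = D w - D s + D w by rewrite {1}DwE PDr PBr.
  apply: dual_ext => f; pose ev (g : B) : R[i] := g f.
  have evD g h : ev (g + h) = ev g + ev h by exact: dualDE.
  have evB g h : ev (g - h) = ev g - ev h by exact: dualBE.
  apply: (@peirce2_scalars R[i] (ev (D w)) (ev w) (ev (D (D w))) (ev s)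
    (ev (D s)) (ev tau)).
  - by rewrite -evB -evD -DwE.
  - by rewrite -evB -evD -DDwE.
  - by rewrite -evB -evD -DsE.
  - by rewrite -evD tauE.
  - by rewrite -evD DDw.
by move: DDw; rewrite !Dw => /eqP; rewrite -subr_eq0 addrK => /eqP.
Qed.

(** Composing with [Q^2] turns [P m _ n] into the map of
    [quad_comp_continuous] after one application of [Q], which is continuous
    because [e] lies in [E]. *)
Lemma peirce2_quad_continuous m n : D m = m -> D n = n ->
  weakstar_continuous (fun x => P m x n).
Proof.
move=> Dm Dn; have -> : (fun x => P m x n) = (fun x => P m (Q (Q x)) n).
  by apply/funext => x; rewrite peirce2_quad.
have cQ := @quad_comp_continuous (J e) m (J e) n.
exact: weakstar_continuous_comp cQ (@Pm e (J e)).
Qed.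

End Tripotent.

(** Different [m] may belong to the Peirce spaces of different tripotents, so
    the middle variable is first handled on the diagonal and then by
    polarization. *)
Lemma peirce2_separately_continuous :
  (forall m, exists2 e, P (J e) (J e) (J e) = J e & P (J e) (J e) m = m) ->
  separately_weakstar_continuous P.
Proof.
move=> He.
have Pmm m : weakstar_continuous (fun x => P m x m).
  by have [e etrip em] := He m; exact: (peirce2_quad_continuous etrip em em).
split=> // m p.
have -> : (fun n => P m n p) =
    (fun n => 2^-1 *: (P (m + p) n (m + p) - P m n m - P p n p)).
  apply/funext => n; rewrite PDl !PDr (Psym p n m).
  move: (P m n m) (P m n p) (P p n p) => a b c.
  have -> : a + b + (b + c) - a - c = b *+ 2.
    by rewrite addrAC addrA addrK [a + b]addrC addrAC addrK mulr2n.
  by rewrite -(scaler_nat 2 b) scalerA mulVf ?pnatr_eq0// scale1r.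
by apply: weakstar_continuousZ; do 2![apply: weakstar_continuousB => //].
Qed.

Lemma unitary_extends u : unitary_tripotent t u -> unitary_tripotent P (J u).
Proof.
move=> [utrip uE]; split; first by rewrite /tripotent PE utrip.
apply/seteqP; split=> // m _; rewrite /peirce2/=.
move: m; apply: weakstar_dense => //; first exact: weakstar_continuous_id.
move=> x; rewrite PE; congr J.
by have : [set: E] x by []; rewrite -uE.
Qed.

End ExtendedTriple.

(** * The iterated limits *)

Section AronBernerArens.
Variables (R : realType) (E : normedModType R[i]).
Variables (t : E -> E -> E -> E) (tJ : jordan_triple_product t).
Local Notation J := (@canonical_embedding R E).
Local Notation B := (bidual E).

Lemma arensDm m n n' p : arens t m (n + n') p = arens t m n p + arens t m n' p.
Proof.
apply: dual_ext => f; rewrite dualDE !(arensE tJ) -linearD; congr (m _).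
apply: dual_ext => x; rewrite dualDE !(slice1E tJ) dualDE.
by rewrite rmorphD.
Qed.

Lemma iterated_cvg_unique (V : normedModType R[i]) (X : Type)
    (g : X -> X -> X -> weakstar V) (F G H : set_system X) (l l' : dual V) :
  ProperFilter F -> ProperFilter G -> ProperFilter H ->
  iterated_cvg g F G H (l : weakstar V) ->
  iterated_cvg g F G H (l' : weakstar V) ->
  l = l'.
Proof.
move=> FF FG FH [h2 [h1 [g2 g1 g0]]] [k2 [k1 [f2 f1 f0]]].
have h2k2 : h2 = k2.
  by apply/funext => x; apply/funext => y; exact: weakstar_unique (g2 x y) (f2 x y).
have h1k1 : h1 = k1.
  apply/funext => x; rewrite h2k2 in g1; exact: weakstar_unique (g1 x) (f1 x).
rewrite h1k1 in g0; exact: weakstar_unique g0 f0.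
Qed.

(** The choice in the definition of [aron_berner] is determined: bounded nets
    converging to [m], [n] and [p] exist, and iterated limits along fixed nets
    are unique. *)
Lemma aron_bernerP (i : 'I_6) (m n p l : B) :
  (forall Fm Fn Fp : set_system E, bounded_wstar_net Fm m ->
    bounded_wstar_net Fn n -> bounded_wstar_net Fp p ->
    aron_berner_limit t i Fm Fn Fp (l : weakstar (dual E))) ->
  aron_berner t i m n p = l.
Proof.
move=> li; rewrite /aron_berner; apply: xget_subset1 => // k k' ki k'i.
have gm := goldstine m; have gn := goldstine n; have gp := goldstine p.
have [Fm _ _] := gm; have [Fn _ _] := gn; have [Fp _ _] := gp.
move: {ki k'i} (ki _ _ _ gm gn gp) (k'i _ _ _ gm gn gp).
rewrite /aron_berner_limit.
by case: (val i) => [|[|[|[|[|_]]]]]; exact: iterated_cvg_unique.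
Qed.

(** When the limit in a variable is taken, the variables to its left still range
    over [E]; this is why continuity in the third and second variables is asked
    only at such points. *)
Lemma iterated_wstar_cvg (s : B -> B -> B -> B) (F G H : set_system E) (a b c : B) :
  (forall x y, weakstar_continuous (s (J x) (J y))) ->
  (forall x p, weakstar_continuous (fun n => s (J x) n p)) ->
  (forall n p, weakstar_continuous (fun m => s m n p)) ->
  bounded_wstar_net F a -> bounded_wstar_net G b -> bounded_wstar_net H c ->
  iterated_cvg (fun x y z => s (J x) (J y) (J z) : weakstar (dual E)) F G H
    (s a b c : weakstar (dual E)).
Proof.
move=> s3 s2 s1 [FF _ Fa] [FG _ Gb] [FH _ Hc].
exists (fun x y => s (J x) (J y) c), (fun x => s (J x) b c); split.
- by move=> x y; exact: cvg_comp Hc (s3 x y c).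
- by move=> x; exact: cvg_comp Gb (s2 x c b).
- exact: cvg_comp Fa (s1 b c a).
Qed.

Lemma aron_berner0E : aron_berner t ord0 = arens t.
Proof.
apply/funext => m; apply/funext => n; apply/funext => p.
apply: aron_bernerP => Fm Fn Fp Fmm Fnn Fpp; rewrite /aron_berner_limit/=.
under eq_fun do under eq_fun do under eq_fun do rewrite -(arensJ tJ).
apply: iterated_wstar_cvg => //.
- exact: arens_continuousr.
- exact: arens_continuousm.
- exact: arens_continuousl.
Qed.

(** A separately continuous extension of [t] is the value of the iterated limits
    in every order, so it is each of the six extensions at once. *)
Lemma separately_continuous_regular (s : B -> B -> B -> B) :
  (forall x y z, s (J x) (J y) (J z) = J (t x y z)) ->
  separately_weakstar_continuous s -> forall i, aron_berner t i = s.
Proof.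
move=> sJ [s1 s2 s3] i.
apply/funext => m; apply/funext => n; apply/funext => p.
apply: aron_bernerP => Fm Fn Fp Fmm Fnn Fpp; rewrite /aron_berner_limit.
case: (val i) => [|[|[|[|[|_]]]]];
  under eq_fun do under eq_fun do under eq_fun do rewrite -sJ.
- exact: (@iterated_wstar_cvg s).
- exact: (@iterated_wstar_cvg (fun a c b => s a b c)).
- exact: (@iterated_wstar_cvg (fun c b a => s a b c)).
- exact: (@iterated_wstar_cvg (fun b a c => s a b c)).
- exact: (@iterated_wstar_cvg (fun c a b => s a b c)).
- exact: (@iterated_wstar_cvg (fun b c a => s a b c)).
Qed.

End AronBernerArens.

Theorem proposition3p12 (R : realType) (E : completeNormedModType R[i])
    (t : E -> E -> E -> E) (t_jordan : jordan_triple_product t)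
    (t0_sym : forall m n p : bidual E, aron_berner t ord0 m n p = aron_berner t ord0 p n m) :
  [/\ (forall m n : bidual E,
        weakstar_continuous (quad (aron_berner t ord0) m m \o quad (aron_berner t ord0) n n)),
      (forall e : E, tripotent t e ->
        forall m n : bidual E,
          peirce2 (aron_berner t ord0) (canonical_embedding e) m ->
          peirce2 (aron_berner t ord0) (canonical_embedding e) n ->
          weakstar_continuous (quad (aron_berner t ord0) m n)),
      ((forall m : bidual E, exists2 e : E, tripotent t e &
          peirce2 (aron_berner t ord0) (canonical_embedding e) m) ->
        separately_weakstar_continuous (aron_berner t ord0) /\ aron_berner_regular t)
    & (forall u : E, unitary_tripotent t u ->
        [/\ unitary_tripotent (aron_berner t ord0) (canonical_embedding u),
            separately_weakstar_continuous (aron_berner t ord0) & aron_berner_regular t])].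
Proof.
pose P := aron_berner t ord0; rewrite -/P in t0_sym *.
have PA : P = arens t by exact: aron_berner0E.
have PE x y z : P (canonical_embedding x) (canonical_embedding y)
    (canonical_embedding z) = canonical_embedding (t x y z).
  by rewrite PA arensJ.
have Pl n p : weakstar_continuous (fun m => P m n p).
  by rewrite PA; exact: arens_continuousl.
have Pm x p : weakstar_continuous (fun n => P (canonical_embedding x) n p).
  by rewrite PA; exact: arens_continuousm.
have PDl m m' n p : P (m + m') n p = P m n p + P m' n p.
  by rewrite PA arensDl.
have PDm m n n' p : P m (n + n') p = P m n p + P m n' p.
  by rewrite PA arensDm.
have regular : separately_weakstar_continuous P -> aron_berner_regular t.
  move=> sP ? i j; have Pi := separately_continuous_regular PE sP.
  by rewrite (Pi i) (Pi j).
have iii : (forall m : bidual E, exists2 e : E, tripotent t e &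
      peirce2 P (canonical_embedding e) m) ->
    separately_weakstar_continuous P /\ aron_berner_regular t.
  move=> He; have sP : separately_weakstar_continuous P.
    apply: (peirce2_separately_continuous t_jordan PE t0_sym Pl Pm PDl PDm).
    by move=> m; have [e et em] := He m; exists e => //; rewrite PE et.
  by split=> //; exact: regular.
split=> //.
- move=> m n.
  exact: (@quad_comp_continuous _ _ _ t_jordan _ PE t0_sym Pl Pm).
- move=> e et m n em en.
  apply: (@peirce2_quad_continuous _ _ _
    t_jordan _ PE t0_sym Pl Pm PDl PDm e) => //.
  by rewrite PE et.
- move=> u uu; have uuP := unitary_extends PE t0_sym Pl uu.
  have [m|sP rt] := iii; last by split.
  by exists u; [exact: uu.1|rewrite uuP.2].
Qed.
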